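(* The rational function $R(u,v)=1-\dfrac{P}{u-v}+\dfrac{Q}{u+v}$ with values in $(\operatorname{End}\mathbb{C}^{N|N})^{\otimes 2}$ satisfies the Yang--Baxter equation in the algebra $(\operatorname{End}\mathbb{C}^{N|N})^{\otimes 3}(u,v,w)$ of rational functions of $u,v,w$ with values in $(\operatorname{End}\mathbb{C}^{N|N})^{\otimes 3}$: $$R_{12}(u,v)\,R_{13}(u,w)\,R_{23}(v,w)=R_{23}(v,w)\,R_{13}(u,w)\,R_{12}(u,v).$$
   Context: Fix an integer $N\ge 1$; the ground field is $\mathbb{C}$. Indices $i,j$ run over $\pm1,\ldots,\pm N$; put $\bar i=0$ if $i>0$ and $\bar i=1$ if $i<0$. The vector space $\mathbb{C}^{N|N}$ is $\mathbb{Z}_2$-graded with standard basis vectors $e_i$ of degree $\bar i$. The matrix units $E_{ij}\in\operatorname{End}\mathbb{C}^{N|N}$ are defined by $E_{ij}e_k=\delta_{jk}e_i$ and have $\mathbb{Z}_2$-degree $\bar i+\bar j$. Tensor products of $\mathbb{Z}_2$-graded algebras have the multiplication $(X\otimes Y)(X'\otimes Y')=XX'\otimes YY'\,(-1)^{\deg X'\deg Y}$ on homogeneous elements. Set $$P=\sum_{i,j}E_{ij}\otimes E_{ji}\,(-1)^{\bar j},\qquad Q=\sum_{i,j}E_{ij}\otimes E_{-i,-j}\,(-1)^{\bar i\bar j+\bar i+\bar j}.$$ For a unital graded algebra $\mathrm{A}$ and $1\le p\le n$ let $\iota_p(X)=1^{\otimes(p-1)}\otimes X\otimes 1^{\otimes(n-p)}\in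 \mathrm{A}^{\otimes n}$. For distinct $p,q$ and $X=X^{(1)}\otimes X^{(2)}\in \mathrm{A}^{\otimes 2}$ put $X_{pq}=\iota_p(X^{(1)})\iota_q(X^{(2)})\in \mathrm{A}^{\otimes n}$, extended by linearity. *)

(* Defs.v *)
From HB Require Import structures.
From mathcomp Require Import all_boot all_order all_algebra.
From mathcomp Require Import reals complex mpoly.

Set Implicit Arguments.
Unset Strict Implicit.
Unset Printing Implicit Defensive.

Import GRing.Theory.
Local Open Scope ring_scope.

(* Finite-dimensional algebras given by structure constants:
   e_a * e_b = \sum_c sc_mul a b c *: e_c  and  1 = \sum_a sc_one a *: e_a. *)
Record strconst (K : fieldType) := Strconst {
  sc_idx : finType;
  sc_mul : sc_idx -> sc_idx -> sc_idx -> K;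
  sc_one : sc_idx -> K;
  sc_mulA : forall a b c d,
    \sum_x sc_mul a b x * sc_mul x c d = \sum_x sc_mul b c x * sc_mul a x d;
  sc_mul1l : forall a b, \sum_x sc_one x * sc_mul x a b = (a == b)%:R;
  sc_mul1r : forall a b, \sum_x sc_one x * sc_mul a x b = (a == b)%:R;
  sc_one_neq0 : exists a, sc_one a != 0 }.

Definition scalg (K : fieldType) (S : strconst K) : Type :=
  {ffun sc_idx S -> K^o}.

HB.instance Definition _ (K : fieldType) (S : strconst K) :=
  GRing.Lmodule.copy (scalg S) {ffun sc_idx S -> K^o}.

Section ScAlg.
Variables (K : fieldType) (S : strconst K).
Implicit Types x y z : scalg S.

Definition scval x (a : sc_idx S) : K := (x : {ffun sc_idx S -> K^o}) a.

Definition scone : scalg S := [ffun a => sc_one a].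
Definition scmul x y : scalg S :=
  [ffun c => \sum_a \sum_b scval x a * scval y b * sc_mul a b c].

Lemma scvalE (f : sc_idx S -> K) a : scval [ffun b => f b : K^o] a = f a.
Proof. by rewrite /scval ffunE. Qed.

Lemma scalgP x y : (forall a, scval x a = scval y a) -> x = y.
Proof. by move=> h; apply/ffunP. Qed.

Lemma scvalD x y a : scval (x + y) a = scval x a + scval y a.
Proof. by rewrite /scval ffunE. Qed.

Lemma scvalZ k x a : scval (k *: x) a = k * scval x a.
Proof. by rewrite /scval ffunE. Qed.

Lemma scmulA : associative scmul.
Proof.
move=> x y z; apply/scalgP => d; rewrite !scvalE.
transitivity (\sum_a \sum_b \sum_c scval x a * scval y b * scval z c *
    \sum_e sc_mul b c e * sc_mul a e d).
  apply: eq_bigr => a _.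
  transitivity (\sum_e \sum_b \sum_c
      scval x a * scval y b * scval z c * (sc_mul b c e * sc_mul a e d)).
    apply: eq_bigr => e _; rewrite scvalE mulr_sumr mulr_suml.
    apply: eq_bigr => b _; rewrite mulr_sumr mulr_suml.
    by apply: eq_bigr => c _; rewrite !mulrA.
  rewrite exchange_big; apply: eq_bigr => b _.
  by rewrite exchange_big; apply: eq_bigr => c _; rewrite mulr_sumr.
transitivity (\sum_a \sum_b \sum_c scval x a * scval y b * scval z c *
    \sum_e sc_mul a b e * sc_mul e c d).
  by apply: eq_bigr => a _; apply: eq_bigr => b _; apply: eq_bigr => c _;
     rewrite sc_mulA.
transitivity (\sum_e \sum_c \sum_a \sum_b
    scval x a * scval y b * scval z c * (sc_mul a b e * sc_mul e c d)).
  transitivity (\sum_a \sum_b \sum_e \sum_c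
    scval x a * scval y b * scval z c * (sc_mul a b e * sc_mul e c d)).
    apply: eq_bigr => a _; apply: eq_bigr => b _.
    rewrite exchange_big; apply: eq_bigr => c _; by rewrite mulr_sumr.
  under eq_bigr => a _ do rewrite exchange_big.
  rewrite exchange_big; apply: eq_bigr => e _.
  under eq_bigr => a _ do rewrite exchange_big.
  by rewrite exchange_big.
apply: eq_bigr => e _; apply: eq_bigr => c _; rewrite scvalE !mulr_suml.
apply: eq_bigr => a _; rewrite !mulr_suml; apply: eq_bigr => b _.
by rewrite -!mulrA; congr (_ * (_ * _)); rewrite mulrCA.
Qed.

Lemma scmul1x : left_id scone scmul.
Proof.
move=> x; apply/scalgP => c; rewrite scvalE exchange_big /=.
rewrite (bigD1 c) //= [X in _ + X]big1 ?addr0 => [|b /negPf bc].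
  under eq_bigr => a _ do rewrite scvalE mulrAC.
  by rewrite -mulr_suml sc_mul1l eqxx mul1r.
under eq_bigr => a _ do rewrite scvalE mulrAC.
by rewrite -mulr_suml sc_mul1l bc mul0r.
Qed.

Lemma scmulx1 : right_id scone scmul.
Proof.
move=> x; apply/scalgP => c; rewrite scvalE.
rewrite (bigD1 c) //= [X in _ + X]big1 ?addr0 => [|b /negPf bc].
  under eq_bigr => a _ do rewrite scvalE -mulrA.
  by rewrite -mulr_sumr sc_mul1r eqxx mulr1.
under eq_bigr => a _ do rewrite scvalE -mulrA.
by rewrite -mulr_sumr sc_mul1r bc mulr0.
Qed.

Lemma scmulDl : left_distributive scmul +%R.
Proof.
move=> x y z; apply/scalgP => c; rewrite scvalD !scvalE -big_split /=.
apply: eq_bigr => a _; rewrite -big_split /=; apply: eq_bigr => b _.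
by rewrite scvalD !mulrDl.
Qed.

Lemma scmulDr : right_distributive scmul +%R.
Proof.
move=> x y z; apply/scalgP => c; rewrite scvalD !scvalE -big_split /=.
apply: eq_bigr => a _; rewrite -big_split /=; apply: eq_bigr => b _.
by rewrite scvalD mulrDr mulrDl.
Qed.

Lemma scone_neq0 : scone != 0.
Proof.
have [a na] := sc_one_neq0 S; apply: contra na => /eqP h.
by move: (congr1 (scval^~ a) h); rewrite scvalE /scval ffunE => /eqP.
Qed.

HB.instance Definition _ := GRing.Zmodule_isNzRing.Build (scalg S)
  scmulA scmul1x scmulx1 scmulDl scmulDr scone_neq0.

Lemma scalg_scalerAl (k : K) x y : k *: (x * y) = (k *: x) * y.
Proof.
apply/scalgP => c; rewrite scvalZ !scvalE mulr_sumr.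
apply: eq_bigr => a _; rewrite mulr_sumr; apply: eq_bigr => b _.
by rewrite scvalZ !mulrA.
Qed.

HB.instance Definition _ :=
  GRing.Lmodule_isLalgebra.Build K (scalg S) scalg_scalerAl.

Lemma scalg_scalerAr (k : K) x y : k *: (x * y) = x * (k *: y).
Proof.
apply/scalgP => c; rewrite scvalZ !scvalE mulr_sumr.
apply: eq_bigr => a _; rewrite mulr_sumr; apply: eq_bigr => b _.
by rewrite scvalZ !mulrA [k * _]mulrC.
Qed.

HB.instance Definition _ :=
  GRing.Lalgebra_isAlgebra.Build K (scalg S) scalg_scalerAr.

Lemma scalg_mulE x y c :
  scval (x * y) c = \sum_a \sum_b scval x a * scval y b * sc_mul a b c.
Proof. exact: scvalE. Qed.

Lemma scalg_oneE a : scval (1 : scalg S) a = sc_one a.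
Proof. exact: scvalE. Qed.

End ScAlg.

(* Unital Z_2-graded algebras of finite dimension over K, equipped with a basis
   of homogeneous elements; [sa_par a] is the degree of [sa_bas a]. *)
Record superalg (K : fieldType) := Superalg {
  sa_car :> algType K;
  sa_idx : finType;
  sa_bas : sa_idx -> sa_car;
  sa_coord : sa_idx -> sa_car -> K;
  sa_coord_scalar : forall a, scalar (sa_coord a);
  sa_par : sa_idx -> bool;
  sa_expand : forall x, x = \sum_a sa_coord a x *: sa_bas a;
  sa_coord_bas : forall a b, sa_coord a (sa_bas b) = (a == b)%:R;
  sa_parM : forall a b c,
    sa_coord c (sa_bas a * sa_bas b) != 0 -> sa_par c = sa_par a (+) sa_par b;
  sa_par1 : forall a, sa_coord a 1 != 0 -> sa_par a = false }.

Section SuperalgTheory.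
Variables (K : fieldType) (A : superalg K).

HB.instance Definition _ (a : sa_idx A) :=
  GRing.isLinear.Build K A K _ (sa_coord a) (sa_coord_scalar a).

Definition sa_homog (d : bool) (x : A) : Prop :=
  forall a, sa_coord a x != 0 -> sa_par a = d.

Lemma sa_coordP (x y : A) : (forall a, sa_coord a x = sa_coord a y) -> x = y.
Proof.
move=> h; rewrite (sa_expand x) (sa_expand y).
by apply: eq_bigr => a _; rewrite h.
Qed.

Lemma sa_coordZ k (x : A) a : sa_coord a (k *: x) = k * sa_coord a x.
Proof. by rewrite linearZ. Qed.

Lemma sa_coordM (x y : A) c : sa_coord c (x * y) =
  \sum_a \sum_b sa_coord a x * sa_coord b y
     * sa_coord c (sa_bas a * sa_bas b).
Proof.
rewrite {1}(sa_expand x) mulr_suml linear_sum; apply: eq_bigr => a _ /=.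
rewrite {1}(sa_expand y) mulr_sumr linear_sum; apply: eq_bigr => b _ /=.
by rewrite -scalerAl -scalerAr !linearZ /= mulrA.
Qed.

Lemma sa_strA a b c d :
  \sum_x sa_coord x (sa_bas a * sa_bas b : A)
     * sa_coord d (sa_bas x * sa_bas c)
  = \sum_x sa_coord x (sa_bas b * sa_bas c : A)
     * sa_coord d (sa_bas a * sa_bas x).
Proof.
transitivity (sa_coord d (sa_bas a * sa_bas b * sa_bas c : A)).
  rewrite {2}(sa_expand (sa_bas a * sa_bas b)) mulr_suml linear_sum.
  by apply: eq_bigr => x _; rewrite -scalerAl linearZ.
rewrite -mulrA {1}(sa_expand (sa_bas b * sa_bas c)) mulr_sumr linear_sum.
by apply: eq_bigr => x _; rewrite -scalerAr linearZ.
Qed.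

Lemma sa_str1l a b :
  \sum_x sa_coord x (1 : A) * sa_coord b (sa_bas x * sa_bas a)
  = (a == b)%:R.
Proof.
rewrite eq_sym -sa_coord_bas -[in RHS](mul1r (sa_bas a)).
rewrite {2}(sa_expand 1) mulr_suml linear_sum.
by apply: eq_bigr => x _; rewrite -scalerAl linearZ.
Qed.

Lemma sa_str1r a b :
  \sum_x sa_coord x (1 : A) * sa_coord b (sa_bas a * sa_bas x)
  = (a == b)%:R.
Proof.
rewrite eq_sym -sa_coord_bas -[in RHS](mulr1 (sa_bas a)).
rewrite {2}(sa_expand 1) mulr_sumr linear_sum.
by apply: eq_bigr => x _; rewrite -scalerAr linearZ.
Qed.

Lemma sa_one_neq0 : exists a, sa_coord a (1 : A) != 0.
Proof.
apply/existsP; apply: contraT; rewrite negb_exists => /forallP h.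
have := oner_neq0 A; rewrite (sa_expand 1) big1 ?eqxx // => a _.
by move: (h a); rewrite negbK => /eqP ->; rewrite scale0r.
Qed.

End SuperalgTheory.

(* The tensor product of superalgebras, on the basis e_a (x) e_b:
   (e_a (x) e_b)(e_a' (x) e_b') = (-1)^(deg e_a' deg e_b) e_a e_a' (x) e_b e_b'.
   The rule for arbitrary homogeneous elements is [stensM] below. *)
Section Tensor.
Variables (K : fieldType) (A B : superalg K).
Local Notation I := (sa_idx A * sa_idx B)%type.

Definition tens_mul (i j k : I) : K :=
  (-1) ^+ (sa_par j.1 && sa_par i.2)
  * (sa_coord k.1 (sa_bas i.1 * sa_bas j.1)
     * sa_coord k.2 (sa_bas i.2 * sa_bas j.2)).

Definition tens_one (i : I) : K :=
  sa_coord i.1 (1 : A) * sa_coord i.2 (1 : B).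

Lemma tens_mulA a b c d :
  \sum_x tens_mul a b x * tens_mul x c d
  = \sum_x tens_mul b c x * tens_mul a x d.
Proof.
pose s : K := (-1) ^+ (sa_par b.1 && sa_par a.2)
  * (-1) ^+ (sa_par c.1 && (sa_par a.2 (+) sa_par b.2)).
transitivity (s * (
    (\sum_x sa_coord x (sa_bas a.1 * sa_bas b.1)
        * sa_coord d.1 (sa_bas x * sa_bas c.1))
  * (\sum_x sa_coord x (sa_bas a.2 * sa_bas b.2)
        * sa_coord d.2 (sa_bas x * sa_bas c.2)))).
  rewrite big_distrlr /= pair_big mulr_sumr; apply: eq_bigr => x _.
  rewrite /tens_mul; have [->|/sa_parM px] :=
    eqVneq (sa_coord x.2 (sa_bas a.2 * sa_bas b.2)) 0.
    by rewrite !(mulr0, mul0r).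
  by rewrite px /s mulrACA; congr (_ * _); rewrite mulrACA.
rewrite !sa_strA big_distrlr /= pair_big mulr_sumr; apply: eq_bigr => x _.
rewrite /tens_mul; have [->|/sa_parM px] :=
  eqVneq (sa_coord x.1 (sa_bas b.1 * sa_bas c.1)) 0.
  by rewrite !(mulr0, mul0r).
rewrite px [RHS]mulrACA; congr (_ * _); last by rewrite mulrACA.
rewrite /s; case: (sa_par b.1); case: (sa_par a.2); case: (sa_par c.1);
  by case: (sa_par b.2); rewrite /= ?expr0 ?expr1 ?mulrNN ?mulr1 ?mul1r.
Qed.

Lemma tens_mul1l a b : \sum_x tens_one x * tens_mul x a b = (a == b)%:R.
Proof.
case: a b => [a1 a2] [b1 b2]; rewrite xpair_eqE -mulnb natrM.
rewrite -(sa_str1l (A := A)) -(sa_str1l (A := B)) big_distrlr /= pair_big.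
apply: eq_bigr => x _; rewrite /tens_one /tens_mul /=.
have [->|/sa_par1 ->] := eqVneq (sa_coord x.2 (1 : B)) 0.
  by rewrite !(mulr0, mul0r).
by rewrite andbF expr0 mul1r mulrACA.
Qed.

Lemma tens_mul1r a b : \sum_x tens_one x * tens_mul a x b = (a == b)%:R.
Proof.
case: a b => [a1 a2] [b1 b2]; rewrite xpair_eqE -mulnb natrM.
rewrite -(sa_str1r (A := A)) -(sa_str1r (A := B)) big_distrlr /= pair_big.
apply: eq_bigr => x _; rewrite /tens_one /tens_mul /=.
have [->|/sa_par1 ->] := eqVneq (sa_coord x.1 (1 : A)) 0.
  by rewrite !(mulr0, mul0r).
by rewrite expr0 mul1r mulrACA.
Qed.

Lemma tens_one_neq0 : exists a, tens_one a != 0.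
Proof.
have [[a na] [b nb]] := (sa_one_neq0 A, sa_one_neq0 B).
by exists (a, b); rewrite mulf_neq0.
Qed.

Definition tens_sc : strconst K :=
  Strconst tens_mulA tens_mul1l tens_mul1r tens_one_neq0.

Definition tens_bas (i : I) : scalg tens_sc := [ffun j => (j == i)%:R].
Definition tens_coord (i : I) (x : scalg tens_sc) : K := scval x i.

Lemma tens_coord_scalar i : scalar (tens_coord i).
Proof. by move=> k x y; rewrite /tens_coord scvalD scvalZ. Qed.
HB.instance Definition _ i :=
  GRing.isLinear.Build K (scalg tens_sc) K _ (tens_coord i)
    (tens_coord_scalar i).

Definition tens_par (i : I) : bool := sa_par i.1 (+) sa_par i.2.

Lemma tens_coord_bas i j : tens_coord i (tens_bas j) = (i == j)%:R.
Proof. exact: scvalE. Qed.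

Lemma tens_expand x : x = \sum_i tens_coord i x *: tens_bas i.
Proof.
apply/scalgP => i; rewrite -[RHS]/(tens_coord i _) linear_sum (bigD1 i) //=.
rewrite linearZ /= tens_coord_bas eqxx big1 ?addr0 => [|j /negPf ji].
  by rewrite [RHS]mulr1.
by rewrite linearZ /= tens_coord_bas eq_sym ji [LHS]mulr0.
Qed.

Lemma tens_basM i j k : tens_coord k (tens_bas i * tens_bas j) = tens_mul i j k.
Proof.
rewrite /tens_coord scalg_mulE (bigD1 i) //= [X in _ + X]big1 ?addr0.
  rewrite (bigD1 j) //= [X in _ + X]big1 ?addr0 => [|b /negPf bj].
    by rewrite !scvalE !eqxx !mul1r.
  by rewrite !scvalE bj mulr0 mul0r.
by move=> a /negPf ai; rewrite big1 // => b _; rewrite scvalE ai !mul0r.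
Qed.

Lemma tens_parM i j k : tens_coord k (tens_bas i * tens_bas j) != 0 ->
  tens_par k = tens_par i (+) tens_par j.
Proof.
rewrite tens_basM /tens_mul mulf_eq0 negb_or => /andP[_].
rewrite mulf_eq0 negb_or => /andP[/sa_parM h1 /sa_parM h2].
by rewrite /tens_par h1 h2 addbACA.
Qed.

Lemma tens_par1 i : tens_coord i 1 != 0 -> tens_par i = false.
Proof.
rewrite /tens_coord scalg_oneE /= mulf_eq0 negb_or.
by case/andP => /sa_par1 h1 /sa_par1 h2; rewrite /tens_par h1 h2.
Qed.

Definition stensor : superalg K :=
  Superalg (sa_car := scalg tens_sc)
    tens_coord_scalar tens_expand tens_coord_bas tens_parM tens_par1.

Arguments stensor : simpl never.

Definition stens (x : A) (y : B) : stensor :=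
  ([ffun i => sa_coord i.1 x * sa_coord i.2 y] : scalg tens_sc).

Lemma stens_coord x y (i : I) :
  sa_coord (s := stensor) i (stens x y) = sa_coord i.1 x * sa_coord i.2 y.
Proof. exact: scvalE. Qed.

Lemma stens_bas (i : I) : sa_bas (s := stensor) i = stens (sa_bas i.1) (sa_bas i.2).
Proof.
apply: sa_coordP => j; rewrite sa_coord_bas stens_coord !sa_coord_bas.
by case: i j => [? ?] [? ?]; rewrite xpair_eqE -mulnb natrM.
Qed.

Lemma stens1 : stens 1 1 = 1.
Proof. exact: erefl. Qed.

Lemma stens_coordM (x y : stensor) (k : I) : sa_coord (s := stensor) k (x * y) =
  \sum_(i : I) \sum_(j : I) sa_coord (s := stensor) i x
    * sa_coord (s := stensor) j y * tens_mul i j k.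
Proof.
rewrite sa_coordM; apply: (@eq_bigr _ _ _ I) => i _.
by apply: (@eq_bigr _ _ _ I) => j _; rewrite -tens_basM.
Qed.

Lemma stensM (dy dx' : bool) (x x' : A) (y y' : B) :
  sa_homog dy y -> sa_homog dx' x' ->
  stens x y * stens x' y' = (-1) ^+ (dx' && dy) *: stens (x * x') (y * y').
Proof.
move=> hy hx'; apply: sa_coordP => k.
rewrite sa_coordZ stens_coord.
rewrite stens_coordM (sa_coordM x) (sa_coordM y).
under eq_bigr => a _ do under eq_bigr => b _ do rewrite !stens_coord.
rewrite [in RHS]big_distrlr [in RHS]pair_bigA mulr_sumr; apply: eq_bigr => a _ /=.
rewrite [in RHS]big_distrlr [in RHS]pair_bigA mulr_sumr; apply: eq_bigr => b _ /=.
rewrite /tens_mul.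
have [->|/hx' ->] := eqVneq (sa_coord b.1 x') 0; first by rewrite !(mulr0, mul0r).
have [->|/hy ->] := eqVneq (sa_coord a.2 y) 0; first by rewrite !(mulr0, mul0r).
rewrite mulrCA; congr (_ * _); rewrite [X in X * _]mulrACA.
exact: mulrACA.
Qed.

End Tensor.
Arguments stensor : simpl never.

Section TensorPower.
Variables (K : fieldType) (A : superalg K).

Fixpoint stpowS (m : nat) : superalg K :=
  if m is m'.+1 then stensor A (stpowS m') else A.

Fixpoint sptensS (m : nat) (x : nat -> A) : stpowS m :=
  match m return stpowS m with
  | 0 => x 1%N
  | m'.+1 => stens (x 1%N) (sptensS m' (fun q => x q.+1))
  end.

(* The n-th tensor power A (x) (A (x) (... (x) A)); only meaningful for n >= 1.
   In particular [stpow 2] is [stensor A A]. *)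
Definition stpow (n : nat) : superalg K := stpowS n.-1.

(* x 1 (x) x 2 (x) ... (x) x n *)
Definition sptens (n : nat) (x : nat -> A) : stpow n := sptensS n.-1 x.

(* For 1 <= p <= n, x in the p-th tensor factor and 1 in the other ones. *)
Definition siota (n p : nat) (x : A) : stpow n :=
  sptens n (fun q => if q == p then x else 1).

Definition spair (n p q : nat) (X : stpow 2) : stpow n :=
  \sum_(a : sa_idx A) \sum_(b : sa_idx A)
    sa_coord ((a, b) : sa_idx (stpow 2)) X
      *: (siota n p (sa_bas a) * siota n q (sa_bas b)).

End TensorPower.

(* Extension of scalars of a finite-dimensional algebra along a morphism of
   fields f : K -> L, i.e. A (x)_K L.  An element is a family of coordinates
   in L with respect to the basis of A. *)
Section ScalarExtension.
Variables (K L : fieldType) (f : {rmorphism K -> L}).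

Section Algebra.
Variable A : superalg K.

Definition ext_mul (a b c : sa_idx A) : L :=
  f (sa_coord c (sa_bas a * sa_bas b)).
Definition ext_one (a : sa_idx A) : L := f (sa_coord a (1 : A)).

Lemma ext_mulA a b c d : \sum_x ext_mul a b x * ext_mul x c d
  = \sum_x ext_mul b c x * ext_mul a x d.
Proof.
rewrite /ext_mul; under eq_bigr => x _ do rewrite -rmorphM.
under [RHS]eq_bigr => x _ do rewrite -rmorphM.
by rewrite -!rmorph_sum /= sa_strA.
Qed.

Lemma ext_mul1l a b : \sum_x ext_one x * ext_mul x a b = (a == b)%:R.
Proof.
rewrite /ext_mul /ext_one; under eq_bigr => x _ do rewrite -rmorphM.
by rewrite -rmorph_sum /= sa_str1l rmorph_nat.
Qed.

Lemma ext_mul1r a b : \sum_x ext_one x * ext_mul a x b = (a == b)%:R.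
Proof.
rewrite /ext_mul /ext_one; under eq_bigr => x _ do rewrite -rmorphM.
by rewrite -rmorph_sum /= sa_str1r rmorph_nat.
Qed.

Lemma ext_one_neq0 : exists a, ext_one a != 0.
Proof. by have [a na] := sa_one_neq0 A; exists a; rewrite fmorph_eq0. Qed.

Definition ext_sc : strconst L :=
  Strconst ext_mulA ext_mul1l ext_mul1r ext_one_neq0.

Definition sext : algType L := scalg ext_sc.

Definition scst (x : A) : sext :=
  ([ffun a => f (sa_coord a x)] : scalg ext_sc).

End Algebra.

(* The L-linear extension of a K-linear map. *)
Definition sextmap (A B : superalg K) (phi : A -> B) (X : sext A) : sext B :=
  \sum_(a : sa_idx A) scval X a *: scst (phi (sa_bas a)).

End ScalarExtension.

(* With N = n.+1, so that N >= 1, the index set {1, ..., N, -1, ..., -N} is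
   'I_(N + N): lshift N k stands for k + 1 and rshift N k for - (k + 1), where k : 'I_N. *)
Section GeneralLinear.
Variables (K : fieldType) (n : nat).
Local Notation N := n.+1.
Local Notation idx := 'I_(N + N).

Definition inegb (i : idx) : bool := if split i is inr _ then true else false.
Definition ineg (i : idx) : idx :=
  match split i with inl k => rshift N k | inr k => lshift N k end.

Definition gl_bas (ij : idx * idx) : 'M[K]_(N + N) := delta_mx ij.1 ij.2.
Definition gl_coord (ij : idx * idx) (X : 'M[K]_(N + N)) : K := X ij.1 ij.2.

Lemma gl_coord_scalar ij : scalar (gl_coord ij).
Proof. by move=> k X Y; rewrite /gl_coord !mxE. Qed.
HB.instance Definition _ ij :=
  GRing.isLinear.Build K 'M[K]_(N + N) K _ (gl_coord ij) (gl_coord_scalar ij).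

Definition gl_par (ij : idx * idx) : bool := inegb ij.1 (+) inegb ij.2.

Lemma gl_expand X : X = \sum_ij gl_coord ij X *: gl_bas ij.
Proof. by rewrite {1}[X]matrix_sum_delta pair_big. Qed.

Lemma gl_coord_bas a b : gl_coord a (gl_bas b) = (a == b)%:R.
Proof. by case: a b => [? ?] [? ?]; rewrite /gl_coord mxE xpair_eqE. Qed.

Lemma gl_parM a b c : gl_coord c (gl_bas a * gl_bas b) != 0 ->
  gl_par c = gl_par a (+) gl_par b.
Proof.
case: a b c => [i j] [k l] [p q].
rewrite /gl_coord /gl_bas /gl_par /= -[_ * _]/(_ *m _) mul_delta_mx_cond.
have [->|_] := eqVneq j k; last by rewrite mulr0n mxE eqxx.
rewrite mulr1n mxE; have [->|_] := eqVneq p i; last by rewrite eqxx.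
have [->|_] := eqVneq q l; last by rewrite eqxx.
by rewrite addbA -[in RHS](addbA (inegb i)) addbb addbF.
Qed.

Lemma gl_par1 a : gl_coord a 1 != 0 -> gl_par a = false.
Proof.
case: a => [i j]; rewrite /gl_coord /gl_par mxE /=.
by have [->|_] := eqVneq i j; rewrite ?addbb // eqxx.
Qed.

(* End(K^{N|N}), N = n.+1, acting on column vectors. *)
Definition EndNN : superalg K :=
  Superalg (sa_car := 'M[K]_(N + N)) gl_coord_scalar gl_expand gl_coord_bas gl_parM gl_par1.

Arguments EndNN : simpl never.

Definition Emx (i j : idx) : EndNN := (delta_mx i j : 'M[K]_(N + N)).

Definition Pmx : stpow EndNN 2 :=
  \sum_(i : idx) \sum_(j : idx) (-1) ^+ inegb j *: stens (Emx i j) (Emx j i).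

Definition Qmx : stpow EndNN 2 :=
  \sum_(i : idx) \sum_(j : idx)
    (-1) ^+ (inegb i * inegb j + inegb i + inegb j)%N
      *: stens (Emx i j) (Emx (ineg i) (ineg j)).

End GeneralLinear.
Arguments EndNN : simpl never.

(* C(u, v, w), for C = R[i] *)
Definition ratfun (R : realType) : fieldType := {fraction {mpoly R[i][3]}}.

Section RMatrix.
Variables (R : realType) (n : nat).
Local Notation C := R[i].
Local Notation F := (ratfun R).

Definition ratc : {rmorphism C -> F} :=
  GRing.RMorphism.clone _ _ ((@tofrac {mpoly C[3]}) \o (@mpolyC 3 C)) _.

Definition ratX (k : 'I_3) : F := @tofrac {mpoly C[3]} 'X_k.

(* (End C^{N|N})^{(x) m} (u, v, w), N = n.+1 *)
Definition ratpow (m : nat) : algType F := sext ratc (stpow (EndNN C n) m).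

Definition Rmx (x y : F) : ratpow 2 :=
  1 - (x - y)^-1 *: scst ratc (Pmx C n) + (x + y)^-1 *: scst ratc (Qmx C n).

Definition Rpq (m p q : nat) (x y : F) : ratpow m :=
  sextmap (spair m p q) (Rmx x y).

End RMatrix.

(* Main.v *)
From HB Require Import structures.
Require Import Defs.
From mathcomp Require Import all_boot all_order all_algebra.
From mathcomp Require Import reals complex mpoly.
From mathcomp Require Import ring.

Set Implicit Arguments.
Unset Strict Implicit.
Unset Printing Implicit Defensive.

Import GRing.Theory.
Local Open Scope ring_scope.

(* Write E_p(ij) for the matrix unit E_ij placed in the p-th tensor factor.  The
   proof only uses that these elements form supercommuting systems of matrix
   units.  From this, P_pq exchanges E_p and E_q by conjugation, P_pq^2 = 1 and
   P_pq = P_qp, while Q_pq absorbs E_p into E_q through a supertransposition,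
   whence Q_qp = - Q_pq, Q_pq^2 = 0, Q_pq P_pq = Q_pq = - P_pq Q_pq and
   Q_pq Q_qr = P_pr Q_qr.  These relations reduce every product of P's and Q's
   on three factors to one of 15 elements, up to sign, as in the periplectic
   Brauer algebra, and the Yang--Baxter equation follows by comparing the
   coefficients of these elements on both sides. *)

(** * Comparing linear combinations coefficient by coefficient *)

Section LinearCombinations.
Variables (F : fieldType) (V : lmodType F).

Inductive lin : Type :=
  LAtom of nat | LAdd of lin & lin | LOpp of lin | LScale of F & lin.

Fixpoint lin_eval (b : seq V) (x : lin) : V :=
  match x with
  | LAtom i => b`_i
  | LAdd y z => lin_eval b y + lin_eval b z
  | LOpp y => - lin_eval b y
  | LScale k y => k *: lin_eval b y
  end.

Fixpoint lin_coef (x : lin) (i : nat) : F :=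
  match x with
  | LAtom j => (i == j)%:R
  | LAdd y z => lin_coef y i + lin_coef z i
  | LOpp y => - lin_coef y i
  | LScale k y => k * lin_coef y i
  end.

Lemma lin_evalE b x :
  lin_eval b x = \sum_(i < size b) lin_coef x i *: b`_i.
Proof.
elim: x => [j|y IHy z IHz|y IHy|k y IHy] /=.
- have [jb|bj] := ltnP j (size b).
    rewrite (bigD1 (Ordinal jb)) //= eqxx scale1r big1 ?addr0 // => i.
    by rewrite -val_eqE /= => /negPf ->; rewrite scale0r.
  rewrite nth_default // big1 // => i _; case: eqP => [ij|_]; last first.
    by rewrite scale0r.
  by have := ltn_ord i; rewrite ij ltnNge bj.
- by rewrite IHy IHz -big_split; apply: eq_bigr => i _; rewrite scalerDl.
- by rewrite IHy -sumrN; apply: eq_bigr => i _; rewrite scaleNr.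
- by rewrite IHy scaler_sumr; apply: eq_bigr => i _; rewrite scalerA.
Qed.

(** Reduces an identity between vectors to one identity in the field for each atom of [b]. An atom
    past the end of [b] evaluates to the default 0, so the indices below [size b] suffice. *)
Lemma lin_eval_eq b x y :
  all (fun i => lin_coef x i == lin_coef y i) (iota 0 (size b)) ->
  lin_eval b x = lin_eval b y.
Proof.
move=> /allP h; rewrite !lin_evalE; apply: eq_bigr => i _.
by rewrite (eqP (h i _)) // mem_iota ltn_ord.
Qed.

End LinearCombinations.

Ltac atom_index a l :=
  match l with
  | ?b :: _ => let _ := match goal with _ => unify a b end in constr:(0%N)
  | _ :: ?l' => let n := atom_index a l' in constr:(n.+1)
  end.

Ltac reify_lin F l x :=
  match x with
  | @GRing.add _ ?y ?z =>
      let y' := reify_lin F l y in let z' := reify_lin F l z in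
      constr:(LAdd y' z')
  | @GRing.opp _ ?y => let y' := reify_lin F l y in constr:(LOpp y')
  | @GRing.scale _ _ ?k ?y =>
      let y' := reify_lin F l y in constr:(@LScale F k y')
  | _ => let n := atom_index x l in constr:(LAtom F n)
  end.

Ltac lin_coefs F l :=
  match goal with |- ?x = ?y =>
    let x' := reify_lin F l x in let y' := reify_lin F l y in
    apply: (@lin_eval_eq F _ l x' y');
    rewrite /=; repeat (apply/andP; split=> //); apply/eqP
  end.

(** * Relations between P and Q over supercommuting matrix units *)

Section MatrixUnits.
Variables (K : fieldType) (A : algType K) (T : eqType) (I : finType).
Variables (par : I -> bool) (neg : I -> I) (e : T -> I -> I -> A).
Hypotheses (negK : involutive neg) (par_neg : forall i, par (neg i) = ~~ par i).
Hypothesis e_mul :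
  forall p i j k l, e p i j * e p k l = (j == k)%:R *: e p i l.
Hypothesis e_sum : forall p, \sum_i e p i i = 1.
Hypothesis e_comm : forall p q i j k l, p != q ->
  e p i j * e q k l =
  (-1) ^+ ((par i (+) par j) && (par k (+) par l)) *: (e q k l * e p i j).

(** [sswap p q] and [sctr p q] are P_pq and Q_pq, written in the units of slots p and q. *)
Definition sswap (p q : T) : A :=
  \sum_i \sum_j (-1) ^+ par j *: (e p i j * e q j i).

Definition sctr (p q : T) : A :=
  \sum_i \sum_j (-1) ^+ (par i * par j + par i + par j)%N
    *: (e p i j * e q (neg i) (neg j)).

(** Mostly used from right to left: inflating a term to a sum over a Kronecker delta lets two sums
    be compared term by term. *)
Let delta_sum (V : lmodType K) (k : I) (G : I -> V) :
  \sum_j (j == k)%:R *: G j = G k.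
Proof.
rewrite (bigD1 k) //= eqxx scale1r big1 ?addr0 // => j /negPf ->.
by rewrite scale0r.
Qed.

Let sum_neg (V : nmodType) (G : I -> V) : \sum_i G i = \sum_i G (neg i).
Proof. exact: reindex_inj (inv_inj negK). Qed.

(** The sign comes from moving [e q k l] past [e p i' j']; each slot then multiplies on its own. *)
Lemma mul_units p q i j k l i' j' k' l' : p != q ->
  e p i j * e q k l * (e p i' j' * e q k' l') =
  ((-1) ^+ ((par k (+) par l) && (par i' (+) par j'))
     * ((j == i')%:R * (l == k')%:R)) *: (e p i j' * e q k l').
Proof.
move=> pq; have qp : q != p by rewrite eq_sym.
rewrite mulrA -(mulrA (e p i j)) (e_comm _ _ _ _ qp).
rewrite -scalerAr -scalerAl (mulrA (e p i j)) e_mul -!scalerAl -mulrA e_mul.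
by rewrite -!scalerAr !scalerA -mulrA.
Qed.

(** Commuting the two factors costs (-1)^(i+j), which turns (-1)^i into (-1)^j. *)
Lemma sswapC p q : p != q -> sswap p q = sswap q p.
Proof.
move=> pq; rewrite /sswap exchange_big; apply: eq_bigr => i _.
apply: eq_bigr => j _; rewrite e_comm // scalerA -exprD -signr_odd.
by case: (par i); case: (par j).
Qed.

(** Negating both indices changes the exponent ij+i+j to ij+1 modulo 2, and commuting the factors
    adds i+j; the 1 left over is the minus sign. *)
Lemma sctrC p q : p != q -> sctr q p = - sctr p q.
Proof.
move=> pq; have qp : q != p by rewrite eq_sym.
rewrite /sctr sum_neg -sumrN; apply: eq_bigr => i _.
rewrite sum_neg -sumrN; apply: eq_bigr => j _.
rewrite !negK !par_neg (e_comm _ _ _ _ qp) scalerA -exprD -scaleN1r scalerA.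
rewrite -exprS -signr_odd -[in RHS]signr_odd !par_neg.
by case: (par i); case: (par j).
Qed.

(** Only products of diagonal units survive, with sign +1, and in each slot these sum to 1. *)
Lemma sswap_sqr p q : p != q -> sswap p q * sswap p q = 1.
Proof.
move=> pq.
transitivity (\sum_i \sum_j (e p i i * e q j j)); last first.
  by under eq_bigr => i _ do rewrite -mulr_sumr e_sum mulr1.
rewrite mulr_suml; apply: eq_bigr => i _.
rewrite mulr_suml; apply: eq_bigr => j _.
transitivity (\sum_k (k == j)%:R *: \sum_l (l == i)%:R *:
   ((-1) ^+ (par j (+) par l (+) ((par j (+) par i) && (par k (+) par l)))
     *: (e p i l * e q j k))); last first.
  rewrite !delta_sum; case: (par i); case: (par j);
  by rewrite /= expr0 scale1r.
rewrite mulr_sumr; apply: eq_bigr => k _.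
rewrite mulr_sumr scaler_sumr; apply: eq_bigr => l _.
rewrite -scalerAl -scalerAr mul_units // !scalerA.
rewrite (eq_sym j) (eq_sym i); congr (_ *: _).
have [_|_] := eqVneq k j; last by rewrite !(mul0r, mulr0).
have [_|_] := eqVneq l i; last by rewrite !(mul0r, mulr0).
by rewrite !mulr1 mul1r -!signr_addb.
Qed.

(** Both sides collapse to the same signed sum over i of [e p i l * e q k i]. *)
Lemma sswap_unit p q k l : p != q ->
  sswap p q * e p k l = e q k l * sswap p q.
Proof.
move=> pq; have qp : q != p by rewrite eq_sym.
transitivity (\sum_i
  (-1) ^+ (par k (+) ((par k (+) par i) && (par k (+) par l)))
    *: (e p i l * e q k i)).
  rewrite mulr_suml; apply: eq_bigr => i _.
  rewrite mulr_suml -[RHS](delta_sum k (fun j =>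
    (-1) ^+ (par k (+) ((par k (+) par i) && (par k (+) par l)))
    *: (e p i l * e q k i))).
  apply: eq_bigr => j _; rewrite -scalerAl -mulrA (e_comm _ _ _ _ qp).
  rewrite -scalerAr mulrA e_mul -scalerAl !scalerA.
  have [->|_] := eqVneq j k; last by rewrite !(mul0r, mulr0) !scale0r.
  by rewrite mulr1 mul1r signr_addb.
rewrite mulr_sumr; apply: eq_bigr => i _; rewrite mulr_sumr.
rewrite -[LHS](delta_sum l (fun l' =>
    (-1) ^+ (par k (+) ((par k (+) par i) && (par k (+) par l)))
    *: (e p i l * e q k i))).
apply: eq_bigr => j _; rewrite -scalerAr mulrA (e_comm _ _ _ _ qp).
rewrite -scalerAl -mulrA e_mul -scalerAr !scalerA (eq_sym l).
have [->|_] := eqVneq j l; last by rewrite !(mul0r, mulr0) !scale0r.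
rewrite mulr1 mul1r -signr_addb.
by case: (par i); case: (par k); case: (par l).
Qed.

(** Each term of [sswap p q] is a product of two units of equal degree, hence even, so the two signs
    cancel. *)
Lemma sswap_unitC p q r k l : r != p -> r != q ->
  sswap p q * e r k l = e r k l * sswap p q.
Proof.
move=> rp rq; have pr : p != r by rewrite eq_sym.
have qr : q != r by rewrite eq_sym.
rewrite mulr_suml mulr_sumr; apply: eq_bigr => i _.
rewrite mulr_suml mulr_sumr; apply: eq_bigr => j _.
rewrite -scalerAl -scalerAr; congr (_ *: _).
rewrite -mulrA (e_comm _ _ _ _ qr) -scalerAr mulrA (e_comm _ _ _ _ pr).
rewrite -scalerAl scalerA mulrA -signr_addb (addbC (par j)) addbb.
by rewrite expr0 scale1r.
Qed.

(** Passing P_pq through each term of P_pr renames slot p to q and leaves slot r fixed. *)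
Lemma sswap_conjP p q r : p != q -> r != p -> r != q ->
  sswap p q * sswap p r = sswap q r * sswap p q.
Proof.
move=> pq rp rq; rewrite mulr_sumr mulr_suml; apply: eq_bigr => i _.
rewrite mulr_sumr mulr_suml; apply: eq_bigr => j _.
by rewrite -scalerAr -scalerAl mulrA sswap_unit // -mulrA sswap_unitC // mulrA.
Qed.

Lemma sswap_conjQ p q r : p != q -> r != p -> r != q ->
  sswap p q * sctr p r = sctr q r * sswap p q.
Proof.
move=> pq rp rq; rewrite mulr_sumr mulr_suml; apply: eq_bigr => i _.
rewrite mulr_sumr mulr_suml; apply: eq_bigr => j _.
by rewrite -scalerAr -scalerAl mulrA sswap_unit // -mulrA sswap_unitC // mulrA.
Qed.

(* The supertransposition (k, l) |-> (-l, -k) lets sctr p q absorb a matrix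
   unit of slot p into slot q. *)
Lemma sctr_unit p q k l : p != q ->
  sctr p q * e p k l =
  (-1) ^+ (par k && par l (+) par l) *: (sctr p q * e q (neg l) (neg k)).
Proof.
move=> pq; have qp : q != p by rewrite eq_sym.
transitivity (\sum_i (-1) ^+ (par k && par l (+) par l) *:
  ((-1) ^+ (par i * par l + par i + par l)%N
    *: (e p i l * e q (neg i) (neg k)))).
  rewrite mulr_suml; apply: eq_bigr => i _.
  rewrite mulr_suml -[RHS](delta_sum k (fun=> _)).
  apply: eq_bigr => j _; rewrite -scalerAl -mulrA (e_comm _ _ _ _ qp).
  rewrite -scalerAr mulrA e_mul -scalerAl !scalerA.
  have [->|_] := eqVneq j k; last by rewrite !(mul0r, mulr0) !scale0r.
  rewrite mulr1 mul1r; congr (_ *: _).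
  rewrite -!exprD -signr_odd -[RHS]signr_odd !par_neg.
  by case: (par i); case: (par k); case: (par l).
rewrite mulr_suml scaler_sumr; apply: eq_bigr => i _; congr (_ *: _).
rewrite mulr_suml -[LHS](delta_sum l (fun=> _)); apply: eq_bigr => j _.
rewrite -scalerAl -mulrA e_mul -scalerAr !scalerA (inj_eq (inv_inj negK)).
have [->|_] := eqVneq j l; last by rewrite !(mul0r, mulr0) !scale0r.
by rewrite mulr1 mul1r.
Qed.

(** Once Q_pq has absorbed the slot p units of P_pq into slot q, the surviving products are the
    diagonal units, with sign +1, and these sum to 1. *)
Lemma sctr_sswap p q : p != q -> sctr p q * sswap p q = sctr p q.
Proof.
move=> pq; transitivity (sctr p q * \sum_i e q i i); last first.
  by rewrite e_sum mulr1.
rewrite /sswap exchange_big sum_neg !mulr_sumr.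
apply: eq_bigr => j _; rewrite mulr_sumr -[RHS](delta_sum j (fun=> _)).
apply: eq_bigr => i _; rewrite -scalerAr mulrA sctr_unit // -scalerAl -mulrA.
rewrite e_mul -!scalerAr !scalerA negK (inj_eq (inv_inj negK)).
have [->|_] := eqVneq i j; last by rewrite !(mul0r, mulr0) !scale0r.
by rewrite mulr1 -signr_addb !par_neg; case: (par j).
Qed.

(** Exchanging the slots gives P_pq Q_pq = Q_qp P_pq, and Q_qp = - Q_pq. *)
Lemma sswap_sctr p q : p != q -> sswap p q * sctr p q = - sctr p q.
Proof.
move=> pq; have qp : q != p by rewrite eq_sym.
rewrite -[in RHS](sctr_sswap pq) -mulNr -sctrC //.
rewrite mulr_sumr mulr_suml; apply: eq_bigr => i _.
rewrite mulr_sumr mulr_suml; apply: eq_bigr => j _.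
rewrite -scalerAr -scalerAl mulrA sswap_unit // -mulrA sswapC //.
by rewrite sswap_unit // mulrA.
Qed.

(** Absorption gives Q_pq^2 = c Q_pq, where c is the sum of all [(-1) ^+ par i], the supertrace of
    the identity; [neg] pairs even indices with odd ones, so c = 0. *)
Lemma sctr_sqr p q : p != q -> sctr p q * sctr p q = 0.
Proof.
move=> pq; rewrite {2}/sctr mulr_sumr.
transitivity (\sum_i (-1) ^+ par i *: sctr p q).
  apply: eq_bigr => i _; rewrite mulr_sumr.
  rewrite -[in RHS](mulr1 (sctr p q)) -[in RHS](e_sum q) [in RHS]sum_neg.
  rewrite mulr_sumr scaler_sumr.
  apply: eq_bigr => j _; rewrite -scalerAr mulrA sctr_unit // -scalerAl.
  rewrite -mulrA e_mul eqxx scale1r scalerA; congr (_ *: _).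
  rewrite -exprD -[LHS]signr_odd -[RHS]signr_odd.
  by case: (par i); case: (par j).
rewrite -scaler_suml.
suff -> : \sum_i (-1) ^+ par i = 0 :> K by rewrite scale0r.
rewrite (bigID par) /= [X in _ + X](reindex_inj (inv_inj negK)) /=.
under [X in _ + X]eq_bigl => i do rewrite par_neg negbK.
rewrite -big_split big1 // => i pi.
by rewrite /= par_neg pi expr0 expr1 addNr.
Qed.

(** Both sides equal - Q_pq P_pr: the left one by absorbing slot p into slot q, the right one by
    conjugation with P_pr and Q_rq = - Q_qr. *)
Lemma sctr_sctr p q r : p != q -> r != p -> r != q ->
  sctr p q * sctr q r = sswap p r * sctr q r.
Proof.
move=> pq rp rq; have qp : q != p by rewrite eq_sym.
have pr : p != r by rewrite eq_sym.
have qr : q != r by rewrite eq_sym.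
transitivity (- (sctr p q * sswap p r)).
  (* With the indices negated and transposed, the absorbed unit is exactly [e q i j], as in
     [sctr q r]. *)
  have -> : sswap p r = \sum_i \sum_j (-1) ^+ par (neg i) *:
      (e p (neg j) (neg i) * e r (neg i) (neg j)).
    rewrite /sswap exchange_big sum_neg; apply: eq_bigr => i _.
    exact: sum_neg.
  rewrite {2}/sctr !mulr_sumr -sumrN; apply: eq_bigr => i _.
  rewrite !mulr_sumr -sumrN.
  apply: eq_bigr => j _.
  rewrite -!scalerAr [in RHS]mulrA sctr_unit // -scalerAl.
  rewrite scalerA -scaleN1r scalerA !negK [in LHS]mulrA; congr (_ *: _).
  rewrite -exprD -exprS -signr_odd -[RHS]signr_odd !par_neg.
  by case: (par i); case: (par j).
by rewrite (sswapC pr) -sswap_conjQ // (sctrC qr) mulrN opprK.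
Qed.

(** * The Yang--Baxter equation over matrix units *)

Definition rmat (p q : T) (x y : K) : A :=
  1 - (x - y)^-1 *: sswap p q + (x + y)^-1 *: sctr p q.

Lemma rmat_yang_baxter p q r x y z : p != q -> p != r -> q != r ->
  x - y != 0 -> x - z != 0 -> y - z != 0 ->
  x + y != 0 -> x + z != 0 -> y + z != 0 ->
  rmat p q x y * rmat p r x z * rmat q r y z =
  rmat q r y z * rmat p r x z * rmat p q x y.
Proof.
move=> pq pr qr nxy nxz nyz nxy' nxz' nyz'.
have [qp rp rq] : [/\ q != p, r != p & r != q] by split; rewrite eq_sym.
rewrite /rmat -!mulrA.
set P12 := sswap p q; set P13 := sswap p r; set P23 := sswap q r.
set Q12 := sctr p q; set Q13 := sctr p r; set Q23 := sctr q r.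
(* [s] and [t] are the two 3-cycles. *)
pose s := P12 * P13; pose t := P13 * P12.
have P12E : sswap q p = P12 by rewrite sswapC.
have P13E : sswap r p = P13 by rewrite sswapC.
have P23E : sswap r q = P23 by rewrite sswapC.
have Q12E : sctr q p = - Q12 by rewrite sctrC.
have Q13E : sctr r p = - Q13 by rewrite sctrC.
have Q23E : sctr r q = - Q23 by rewrite sctrC.
have P12_2 : P12 * P12 = 1 by rewrite sswap_sqr.
have P23_2 : P23 * P23 = 1 by rewrite sswap_sqr.
have P12P13 : P12 * P13 = s by [].
have P13P12 : P13 * P12 = t by [].
have P23P12 : P23 * P12 = s by rewrite -(sswap_conjP pq rp rq).
have P13P23 : P13 * P23 = s.
  by have := sswap_conjP rp qr qp; rewrite P13E P23E => ->.
have P12P23 : P12 * P23 = t.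
  by have := sswap_conjP qp rq rp; rewrite P12E => ->.
have P23P13 : P23 * P13 = t.
  by have := sswap_conjP rq pr pq; rewrite P23E P13E P12E => ->.
(* The quadratic relations with a Q are oriented so that a single Q is left, at the right end. *)
have Q12P12 : Q12 * P12 = Q12 by apply: sctr_sswap.
have Q12P13 : Q12 * P13 = - (P13 * Q23).
  by have := sswap_conjQ rp qr qp; rewrite P13E Q23E mulrN => <-.
have Q12P23 : Q12 * P23 = P23 * Q13.
  have := sswap_conjQ rq pr pq.
  by rewrite P23E Q13E Q12E mulrN mulNr => /oppr_inj ->.
have Q13P12 : Q13 * P12 = P12 * Q23.
  by have := sswap_conjQ qp rq rp; rewrite P12E => <-.
have Q13P23 : Q13 * P23 = P23 * Q12.
  have := sswap_conjQ qr pq pr.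
  by rewrite Q12E Q13E mulrN mulNr => /oppr_inj ->.
have Q23P12 : Q23 * P12 = P12 * Q13 by rewrite -(sswap_conjQ pq rp rq).
have Q23P13 : Q23 * P13 = - (P13 * Q12).
  by have := sswap_conjQ pr qp qr; rewrite Q23E mulNr => ->; rewrite opprK.
have Q23P23 : Q23 * P23 = Q23 by apply: sctr_sswap.
have Q12Q13 : Q12 * Q13 = - (P23 * Q13).
  by have := sctr_sctr qp rq rp; rewrite Q12E mulNr => <-; rewrite opprK.
have Q12Q23 : Q12 * Q23 = P13 * Q23 by apply: sctr_sctr.
have Q13Q23 : Q13 * Q23 = P12 * Q23.
  have := sctr_sctr pr qp qr.
  by rewrite Q23E !mulrN => /oppr_inj.
have Q13Q12 : Q13 * Q12 = - (P23 * Q12).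
  have := sctr_sctr rp qr qp.
  by rewrite Q13E P23E mulNr => <-; rewrite opprK.
have Q23Q13 : Q23 * Q13 = P12 * Q13.
  have := sctr_sctr qr pq pr.
  by rewrite Q13E P12E !mulrN => /oppr_inj.
have Q23Q12 : Q23 * Q12 = - (P13 * Q12).
  have := sctr_sctr rq pr pq.
  by rewrite Q23E Q12E P13E mulrN mulNr opprK mulrN.
have P12Q12 : P12 * Q12 = - Q12 by apply: sswap_sctr.
have P23Q23 : P23 * Q23 = - Q23 by apply: sswap_sctr.
(* Cubic products: P12 and Q12 meet the normal forms of the inner products on the left side, then
   P23 and Q23 those on the right side. *)
have P12s : P12 * s = P13 by rewrite mulrA P12_2 mul1r.
have P12P13Q23 : P12 * (P13 * Q23) = - (P13 * Q23).
  by rewrite mulrA P12P13 -P13P23 -mulrA P23Q23 mulrN.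
have P12P23Q12 : P12 * (P23 * Q12) = - (P13 * Q12).
  by rewrite mulrA P12P23 -P13P12 -mulrA P12Q12 mulrN.
have P12P12Q23 : P12 * (P12 * Q23) = Q23 by rewrite mulrA P12_2 mul1r.
have Q12s : Q12 * s = - (P13 * Q23) by rewrite mulrA Q12P12.
have Q12P13Q23 : Q12 * (P13 * Q23) = 0.
  by rewrite mulrA Q12P13 mulNr -mulrA sctr_sqr // mulr0 oppr0.
have Q12P23Q12 : Q12 * (P23 * Q12) = - Q12.
  by rewrite mulrA Q12P23 -mulrA Q13Q12 mulrN mulrA P23_2 mul1r.
have Q12P12Q23 : Q12 * (P12 * Q23) = P13 * Q23 by rewrite mulrA Q12P12.
have P23t : P23 * t = P13 by rewrite -P23P13 mulrA P23_2 mul1r.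
have P23P13Q12 : P23 * (P13 * Q12) = - (P13 * Q12).
  by rewrite mulrA P23P13 -P13P12 -mulrA P12Q12 mulrN.
have P23P12Q23 : P23 * (P12 * Q23) = - (P13 * Q23).
  by rewrite mulrA P23P12 -P13P23 -mulrA P23Q23 mulrN.
have P23P23Q12 : P23 * (P23 * Q12) = Q12 by rewrite mulrA P23_2 mul1r.
have Q23t : Q23 * t = - (P13 * Q12) by rewrite -P23P13 mulrA Q23P23.
have Q23P13Q12 : Q23 * (P13 * Q12) = 0.
  by rewrite mulrA Q23P13 mulNr -mulrA sctr_sqr // mulr0 oppr0.
have Q23P12Q23 : Q23 * (P12 * Q23) = Q23.
  by rewrite mulrA Q23P12 -mulrA Q13Q23 mulrA P12_2 mul1r.
have Q23P23Q12 : Q23 * (P23 * Q12) = - (P13 * Q12).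
  by rewrite mulrA Q23P23.
(* The 15 atoms below are the diagrams with three strands of the Brauer algebra:
   the 6 permutations and the 9 products of a cup and a cap. *)
clearbody P12 P13 P23 Q12 Q13 Q23 s t.
pose expand := (@mulrDl A, @mulrDr A, @mulNr A, @mulrN A, @mul1r A, @mulr1 A,
  @mulr0 A, =^~ @scalerAl K A, =^~ @scalerAr K A).
rewrite !mulrDl !mulrDr !mul1r !mulr1 !mulNr !mulrN -!scalerAl -!scalerAr.
(* Products are associated to the right; the inner ones are normalised first, then their products
   with the outer factor. *)
rewrite !(expand, P12P13, P13P12, P12P23, P23P12, P13P23, P23P13).
rewrite !(expand, Q12P13, Q12P23, Q13P12, Q13P23, Q23P12, Q23P13).
rewrite !(expand, Q12Q13, Q13Q12, Q12Q23, Q23Q12, Q13Q23, Q23Q13).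
rewrite !(expand, P12s, P12P13Q23, P12P23Q12, P12P12Q23).
rewrite !(expand, Q12s, Q12P13Q23, Q12P23Q12, Q12P12Q23).
rewrite !(expand, P23t, P23P13Q12, P23P12Q23, P23P23Q12).
rewrite !(expand, Q23t, Q23P13Q12, Q23P12Q23, Q23P23Q12).
rewrite !scaler0 ?addr0 ?subr0.
lin_coefs K [:: (1 : A); P12; P13; P23; s; t; Q12; Q13; Q23; P12 * Q13;
  P12 * Q23; P13 * Q12; P13 * Q23; P23 * Q12; P23 * Q13].
(* What remains are identities between coefficients, rational expressions in x, y and z. *)
all: by field; rewrite nxy nxz nyz nxy' nxz' nyz'.
Qed.

End MatrixUnits.

(** * Homogeneous elements and elementary tensors *)

Section Homogeneous.
Variables (K : fieldType) (A : superalg K).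

Lemma sa_coordD (x y : A) a : sa_coord a (x + y) = sa_coord a x + sa_coord a y.
Proof. exact: linearD. Qed.

Lemma homog_bas a : sa_homog (sa_par a) (sa_bas a : A).
Proof.
move=> b; rewrite sa_coord_bas; case: (b =P a) => [-> //|_].
by rewrite eqxx.
Qed.

Lemma homog1 : sa_homog false (1 : A).
Proof. exact: sa_par1. Qed.

End Homogeneous.

Section TensorFactors.
Variables (K : fieldType) (A B : superalg K).

Lemma homog_stens d d' (x : A) (y : B) : sa_homog d x -> sa_homog d' y ->
  sa_homog (d (+) d') (stens x y).
Proof.
move=> hx hy i; rewrite stens_coord mulf_eq0 negb_or => /andP[/hx <- /hy <-].
by [].
Qed.

Lemma stens_linearl k (x x' : A) (y : B) :
  stens (k *: x + x') y = k *: stens x y + stens x' y.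
Proof.
apply: sa_coordP => i; rewrite sa_coordD sa_coordZ !stens_coord.
by rewrite sa_coordD sa_coordZ mulrDl mulrA.
Qed.

Lemma stens_linearr k (x : A) (y y' : B) :
  stens x (k *: y + y') = k *: stens x y + stens x y'.
Proof.
apply: sa_coordP => i; rewrite sa_coordD sa_coordZ !stens_coord.
by rewrite sa_coordD sa_coordZ mulrDr mulrCA.
Qed.

Lemma stensZr k (x : A) (y : B) : stens x (k *: y) = k *: stens x y.
Proof.
by apply: sa_coordP => i; rewrite sa_coordZ !stens_coord sa_coordZ mulrCA.
Qed.

End TensorFactors.

(** * Elements placed in one or two tensor factors *)

Section TensorPowerFactors.
Variables (K : fieldType) (A : superalg K).

(* x in position k of m + 1 tensor factors, both counted from 0 (for k > m the
   last position is used); unlike siota it recurses on the position. *)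
Fixpoint factor (m k : nat) (x : A) : stpowS A m :=
  match m return stpowS A m with
  | 0 => x
  | m'.+1 => if k is k'.+1 then stens 1 (factor m' k' x) else stens x 1
  end.

(** The value at 0 is never read; after one shift, the family behind [siota] at position 1 differs
    from 1 only there. *)
Lemma eq_sptensS m (x y : nat -> A) :
  (forall q, (0 < q)%N -> x q = y q) -> sptensS m x = sptensS m y.
Proof.
elim: m x y => [|m IH] x y xy /=; first exact: xy.
by rewrite xy // (IH _ (fun q => y q.+1)) // => q _; apply: xy.
Qed.

(** Passes from positions counted from 1 to positions counted from 0, in a form fit for induction on
    the position. *)
Lemma siota_factor n k x : (k <= n)%N -> siota n.+1 k.+1 x = factor n k x.
Proof.
have sptens1 m : sptensS m (fun=> 1 : A) = 1.
  by elim: m => //= m ->; exact: stens1.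
rewrite /siota /sptens /=; elim: n k => [|n IH] [|k] //= kn.
  rewrite (@eq_sptensS _ _ (fun=> 1)) ?sptens1 // => q q0.
  by rewrite eqSS eqn0Ngt q0.
exact: (congr1 (stens 1) (IH k kn)).
Qed.

Lemma factor_linear m k : linear (factor m k).
Proof.
elim: m k => [|m IH] [|k] c x y //=; first exact: stens_linearl.
by rewrite IH stens_linearr.
Qed.

Lemma factor1 m k : factor m k 1 = 1.
Proof. by elim: m k => [|m IH] [|k] //=; rewrite ?IH stens1. Qed.

Lemma homog_factor m k d x : sa_homog d x -> sa_homog d (factor m k x).
Proof.
move=> hx; elim: m k => [|m IH] [|k] //=.
  by rewrite -[d]addbF; apply: homog_stens => //; apply: homog1.
by rewrite -[d]addFb; apply: homog_stens => //; apply: homog1.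
Qed.

(** All other factors are 1, of degree 0, so no sign appears. *)
Lemma factorM m k d d' x y : sa_homog d x -> sa_homog d' y ->
  factor m k x * factor m k y = factor m k (x * y).
Proof.
move=> hx hy; elim: m k => [|m IH] [|k] //=.
  by rewrite (stensM _ _ (@homog1 _ _) hy) andbF scale1r mulr1.
rewrite (stensM _ _ (@homog_factor m k _ _ hx) (@homog1 _ _)).
by rewrite scale1r IH mulr1.
Qed.

(** The sign arises when exactly one position is 0: one order of multiplication moves the two
    elements past each other, the other does not. The bounds keep distinct positions apart, since
    [factor] sends every k > m to the last one. *)
Lemma factor_comm m k l d d' x y : (k <= m)%N -> (l <= m)%N -> k != l ->
  sa_homog d x -> sa_homog d' y ->
  factor m k x * factor m l y =
  (-1) ^+ (d && d') *: (factor m l y * factor m k x).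
Proof.
move=> km lm kl hx hy; elim: m k l km lm kl => [|m IH] [|k] [|l] //= km lm kl.
- rewrite (stensM _ _ (@homog1 _ _) (@homog1 _ _)).
  rewrite (stensM _ _ (@homog_factor m l _ _ hy) hx) !mulr1 !mul1r.
  by rewrite scale1r scalerA -signr_addb addbb scale1r.
- rewrite (stensM _ _ (@homog_factor m k _ _ hx) hy).
  rewrite (stensM _ _ (@homog1 _ _) (@homog1 _ _)) !mulr1 !mul1r.
  by rewrite scale1r andbC.
rewrite (stensM _ _ (@homog_factor m k _ _ hx) (@homog1 _ _)).
rewrite (stensM _ _ (@homog_factor m l _ _ hy) (@homog1 _ _)).
by rewrite !scale1r !mulr1 IH // stensZr.
Qed.

HB.instance Definition _ m k := GRing.isLinear.Build K A (stpowS A m) _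
  (factor m k) (factor_linear m k).

Lemma spair_linear n p q : linear (@spair K A n p q).
Proof.
move=> k X Y; rewrite /spair scaler_sumr -big_split; apply: eq_bigr => a _.
rewrite scaler_sumr -big_split; apply: eq_bigr => b _.
by rewrite sa_coordD sa_coordZ scalerDl scalerA.
Qed.

HB.instance Definition _ n p q := GRing.isLinear.Build K (stpow A 2) (stpow A n)
  _ (@spair K A n p q) (spair_linear n p q).

Lemma spair_stens n p q x y : (p <= n)%N -> (q <= n)%N ->
  spair n.+1 p.+1 q.+1 (stens x y) = factor n p x * factor n q y.
Proof.
move=> pn qn; rewrite [x in RHS]sa_expand [y in RHS]sa_expand !linear_sum.
rewrite mulr_suml; apply: eq_bigr => a _.
rewrite mulr_sumr; apply: eq_bigr => b _.
by rewrite stens_coord !linearZ -scalerAl -scalerAr scalerA !siota_factor.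
Qed.

(** Fits both [Pmx] and [Qmx], which are double sums of this shape. *)
Lemma spair_sum n p q (I : finType) (c : I -> I -> K) (x y : I -> I -> A) :
  (p <= n)%N -> (q <= n)%N ->
  spair n.+1 p.+1 q.+1 (\sum_i \sum_j c i j *: stens (x i j) (y i j)) =
  \sum_i \sum_j c i j *: (factor n p (x i j) * factor n q (y i j)).
Proof.
move=> pn qn; rewrite linear_sum; apply: eq_bigr => i _.
rewrite linear_sum; apply: eq_bigr => j _.
by rewrite linearZ; congr (_ *: _); apply: spair_stens.
Qed.

Lemma spair1 n p q : (p <= n)%N -> (q <= n)%N ->
  spair n.+1 p.+1 q.+1 (1 : stpow A 2) = 1.
Proof.
by move=> pn qn; rewrite -(stens1 A A) spair_stens // !factor1 mulr1.
Qed.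

End TensorPowerFactors.

(** * Extension of scalars *)

Section ScalarExtensionTheory.
Variables (K L : fieldType) (f : {rmorphism K -> L}).

Section Embedding.
Variable A : superalg K.

Lemma scstD (x y : A) : scst f (x + y) = scst f x + scst f y.
Proof.
by apply/scalgP => a; rewrite scvalD !scvalE sa_coordD rmorphD.
Qed.

Lemma scstZ k (x : A) : scst f (k *: x) = f k *: scst f x.
Proof.
by apply/scalgP => a; rewrite scvalZ !scvalE sa_coordZ rmorphM.
Qed.

Lemma scst0 : scst f (0 : A) = 0.
Proof. by rewrite -[in LHS](scale0r 0) scstZ rmorph0 scale0r. Qed.

Lemma scst_sum (I : finType) (F : I -> A) :
  scst f (\sum_i F i) = \sum_i scst f (F i).
Proof. exact: (big_morph _ scstD scst0). Qed.

Lemma scst1 : scst f (1 : A) = 1.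
Proof. by []. Qed.

Lemma scstM (x y : A) : scst f (x * y) = scst f x * scst f y.
Proof.
apply/scalgP => c; rewrite scalg_mulE scvalE sa_coordM rmorph_sum.
apply: eq_bigr => a _; rewrite rmorph_sum; apply: eq_bigr => b _.
by rewrite !scvalE !rmorphM.
Qed.

End Embedding.

Variables A B : superalg K.

Lemma sextmap_linear (phi : A -> B) : linear (sextmap (f := f) phi).
Proof.
move=> k X Y; rewrite /sextmap scaler_sumr -big_split; apply: eq_bigr => a _.
by rewrite scvalD scvalZ scalerDl scalerA.
Qed.

Lemma sextmap_scst (phi : {linear A -> B}) x :
  sextmap phi (scst f x) = scst f (phi x).
Proof.
rewrite [x in RHS]sa_expand linear_sum scst_sum; apply: eq_bigr => a _.
by rewrite linearZ scstZ scvalE.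
Qed.

End ScalarExtensionTheory.

(** Fits the shape of [Rmx]; its summand 1 is treated as the constant [scst f 1]. *)
Lemma sextmap_spair (K L : fieldType) (f : {rmorphism K -> L}) (A : superalg K)
    n p q a b (X Y : stpow A 2) : (p <= n)%N -> (q <= n)%N ->
  sextmap (spair n.+1 p.+1 q.+1) (1 - a *: scst f X + b *: scst f Y) =
  1 - a *: scst f (spair n.+1 p.+1 q.+1 X)
    + b *: scst f (spair n.+1 p.+1 q.+1 Y).
Proof.
move=> pn qn; rewrite -(scst1 f (stpow A 2)).
(* Linearity is stated for [k *: X + Y], so a scaled summand is brought to the front each time. *)
rewrite addrC sextmap_linear -scaleNr (addrC (scst f 1)) sextmap_linear.
rewrite !sextmap_scst scaleNr addrC (addrC (- _)); congr (_ - _ + _).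
exact: (congr1 (fun Z => scst f Z) (spair1 A pn qn)).
Qed.

(** * The sign change on indices *)

Section IndexInvolution.
Variable n : nat.
Local Notation N := n.+1.
Implicit Type i : 'I_(N + N).

Lemma split_lshift (k : 'I_N) : split (lshift N k) = inl k.
Proof. exact: (unsplitK (inl k)). Qed.

Lemma split_rshift (k : 'I_N) : split (rshift N k) = inr k.
Proof. exact: (unsplitK (inr k)). Qed.

Lemma inegK : involutive (@ineg n).
Proof.
move=> i; rewrite /ineg.
by case: (split_ordP i) => k ->; rewrite ?split_lshift ?split_rshift.
Qed.

Lemma inegb_neg i : inegb (ineg i) = ~~ inegb i.
Proof.
rewrite /ineg /inegb.
by case: (split_ordP i) => k _; rewrite ?split_lshift ?split_rshift.
Qed.

End IndexInvolution.

(** * Matrix units in three tensor factors *)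

Section MatrixUnitFactors.
Variables (R : realType) (n : nat).
Local Notation C := R[i].
Local Notation F := (ratfun R).
Local Notation N := n.+1.
Local Notation idx := 'I_(N + N).

(** The concrete system of units to which the relations above are applied; the slots form ['I_3] and
    count from 0. *)
Definition unit_factor (p : 'I_3) (i j : idx) : ratpow R n 3 :=
  scst (ratc R) (factor 2 p (Emx C i j)).

Lemma homog_Emx (i j : idx) :
  sa_homog (inegb i (+) inegb j) (Emx C i j).
Proof. exact: (@homog_bas _ (EndNN C n) (i, j)). Qed.

Lemma unit_factorM p i j k l :
  unit_factor p i j * unit_factor p k l = (j == k)%:R *: unit_factor p i l.
Proof.
rewrite /unit_factor -scstM (factorM _ _ (@homog_Emx _ _) (@homog_Emx _ _)).
rewrite -[_ * _]/(delta_mx i j *m delta_mx k l) mul_delta_mx_cond.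
case: eqP => _; first by rewrite mulr1n scale1r.
by rewrite mulr0n scale0r linear0 scst0.
Qed.

Lemma unit_factor_sum p : \sum_i unit_factor p i i = 1.
Proof.
transitivity (scst (ratc R) (factor 2 p (\sum_(i : idx) Emx C i i))).
  by rewrite linear_sum scst_sum.
rewrite -[X in factor _ _ X]/(\sum_(i : idx) delta_mx i i) -mx1_sum_delta.
by rewrite factor1.
Qed.

Lemma unit_factor_comm p q i j k l : p != q ->
  unit_factor p i j * unit_factor q k l =
  (-1) ^+ ((inegb i (+) inegb j) && (inegb k (+) inegb l))
    *: (unit_factor q k l * unit_factor p i j).
Proof.
move=> pq; rewrite /unit_factor -!scstM.
rewrite (factor_comm _ _ pq (@homog_Emx _ _) (@homog_Emx _ _)).
- by rewrite scstZ rmorphXn rmorphN1.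
(* By conversion, p < 3 is the bound p <= 2. *)
- exact: ltn_ord p.
- exact: ltn_ord q.
Qed.

(** P and Q match [sswap] and [sctr] summand by summand, because [ratc] preserves signs. *)
Lemma Rpq_rmat (p q : 'I_3) (x y : F) : Rpq n 3 p.+1 q.+1 x y =
  rmat (@inegb n) (@ineg n) unit_factor p q x y.
Proof.
rewrite /Rpq /Rmx.
rewrite (@sextmap_spair _ _ _ _ 2 p q _ _ _ _ (ltn_ord p) (ltn_ord q)).
congr (_ - _ *: _ + _ *: _).
- rewrite (@spair_sum _ _ 2 p q _ _ _ _ (ltn_ord p) (ltn_ord q)).
  rewrite scst_sum; apply: eq_bigr => i _.
  rewrite scst_sum; apply: eq_bigr => j _.
  by rewrite scstZ rmorphXn rmorphN1 scstM.
- rewrite (@spair_sum _ _ 2 p q _ _ _ _ (ltn_ord p) (ltn_ord q)).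
  rewrite scst_sum; apply: eq_bigr => i _.
  rewrite scst_sum; apply: eq_bigr => j _.
  by rewrite scstZ rmorphXn rmorphN1 scstM.
Qed.

End MatrixUnitFactors.

(** * Nonvanishing denominators and the conclusion *)

Lemma ratX_sub_neq0 (R : realType) (i j : 'I_3) :
  i != j -> ratX R i - ratX R j != 0.
Proof.
move=> ij; rewrite /ratX -rmorphB tofrac_eq0.
(* The variable of index i has coefficient 1, so the polynomial is not 0. *)
apply/eqP => /(congr1 (mcoeff U_(i))).
rewrite mcoeffB !mcoeffXU eqxx eq_sym (negPf ij) subr0 mcoeff0 => /eqP.
by rewrite oner_eq0.
Qed.

Lemma ratX_add_neq0 (R : realType) (i j : 'I_3) :
  i != j -> ratX R i + ratX R j != 0.
Proof.
move=> ij; rewrite /ratX -rmorphD tofrac_eq0.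
apply/eqP => /(congr1 (mcoeff U_(i))).
rewrite mcoeffD !mcoeffXU eqxx eq_sym (negPf ij) addr0 mcoeff0 => /eqP.
by rewrite oner_eq0.
Qed.

Theorem theorem1 (R : realType) (n : nat) :
  let u := ratX R 0 in let v := ratX R 1 in let w := ratX R 2 in
  Rpq n 3 1 2 u v * Rpq n 3 1 3 u w * Rpq n 3 2 3 v w
  = Rpq n 3 2 3 v w * Rpq n 3 1 3 u w * Rpq n 3 1 2 u v.
Proof.
move=> u v w.
(* Tensor factors 1, 2, 3 are the slots 0, 1, 2. *)
rewrite (@Rpq_rmat R n 0 1) (@Rpq_rmat R n 0 2) (@Rpq_rmat R n 1 2).
apply: rmat_yang_baxter => //; rewrite ?ratX_sub_neq0 ?ratX_add_neq0 //.
- exact: inegK.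
- exact: inegb_neg.
- exact: unit_factorM.
- exact: unit_factor_sum.
- exact: unit_factor_comm.
Qed.
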